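(* For each $i\ge 6$, let $\alpha_i=\mathtt{a}$ if $i$ is even and $\alpha_i=\mathtt{b}$ if $i$ is odd, and let $\overline{\alpha_i}$ be the other letter. Then the set of minimal unique substrings of $F_i$ is $\{\alpha_i\,G_{i-3}\,\alpha_i,\ \overline{\alpha_i}\,G_{i-2}\,\overline{\alpha_i}\}$.
   Context: The Fibonacci morphism is $\varphi(\mathtt{a})=\mathtt{ab}$, $\varphi(\mathtt{b})=\mathtt{a}$; $F_i=\varphi^{i-1}(\mathtt{b})$ for $i\ge1$ (so $F_1=\mathtt{b}$, $F_2=\mathtt{a}$, $F_i=F_{i-1}F_{i-2}$), $f_i=|F_i|$, and $G_i=F_i[1..f_i-2]$ for $i\ge3$. A minimal unique substring (MUS) of $w$ is a substring $u$ occurring exactly once in $w$, say at $[i,j]$, such that both $w[i+1..j]$ and $w[i..j-1]$ occur at least twice in $w$ (the empty word is considered to occur $|w|+1$ times). *)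

(* Defs.v *)
From HB Require Import structures.
From mathcomp Require Import all_boot.

Set Implicit Arguments.
Unset Strict Implicit.
Unset Printing Implicit Defensive.

Inductive letter := a | b.

Definition bool_of_letter (c : letter) : bool := if c is a then false else true.
Definition letter_of_bool (x : bool) : letter := if x then b else a.

Lemma bool_of_letterK : cancel bool_of_letter letter_of_bool.
Proof. by case. Qed.

HB.instance Definition _ := Equality.copy letter (can_type bool_of_letterK).

Definition compl (c : letter) : letter := if c is a then b else a.

Definition word := seq letter.

Definition phi_letter (c : letter) : word := if c is a then [:: a; b] else [:: a].

Definition phi (w : word) : word := flatten (map phi_letter w).

(* Only meaningful for i >= 1; F 0 is a junk value, equal to F 1. *)
Definition F (i : nat) : word := iter i.-1 phi [:: b].

(* The factor w[i..j], with 1-based inclusive positions 1 <= i and j <= |w|;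
   it is the empty word when j = i - 1. *)
Definition factor (w : word) (i j : nat) : word := take (j.+1 - i) (drop i.-1 w).

Definition G (i : nat) : word := factor (F i) 1 (size (F i) - 2).

(* Number of occurrences of u in w, counted over the offsets 0..|w|, so that the
   empty word occurs |w| + 1 times. *)
Definition nocc (u w : word) : nat :=
  count (fun p => prefix u (drop p w)) (iota 0 (size w).+1).

Definition is_MUS (w u : word) : Prop :=
  nocc u w = 1 /\
  exists i j : nat,
    [/\ 1 <= i <= j /\ j <= size w,
        u = factor w i j,
        2 <= nocc (factor w i.+1 j) w &
        2 <= nocc (factor w i j.-1) w].

Definition alpha (i : nat) : letter := if odd i then b else a.

(* Main.v *)
Require Import Defs.
From mathcomp Require Import all_boot.
From mathcomp Require Import zify.

(** Write [F i = F (i-1) F (i-2) = F (i-2) F (i-3) F (i-2)]. Since [F (i-1) F (i-2)]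
    and [F (i-2) F (i-1)] agree except for their last two letters, the first candidate
    occurs at offset [f_(i-2) - 1] and the second one at offset [f_(i-1) - 1].
    Neither occurs elsewhere: occurrences desubstitute uniquely through [phi], down
    to [i = 6]. An interval of positions containing neither of these two
    occurrences lies in the prefix [G (i-1)], in the copy of [G (i-1)] at offset
    [f_(i-2)], or in the suffix [F (i-2)], which is also a prefix; so its factor
    is repeated, and the only minimal unique factors are the two candidates. *)

(** * Repeated factors and occurrence counts *)

Definition repeated (u w : word) : Prop :=
  exists x y x' y', [/\ w = x ++ u ++ y, w = x' ++ u ++ y' & x <> x'].

Lemma repeated_infix (l v r w : word) : repeated (l ++ v ++ r) w -> repeated v w.
Proof.
move=> [x [y [x' [y' [e e' nx]]]]].
exists (x ++ l), (r ++ y), (x' ++ l), (r ++ y').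
split; first by rewrite e -!catA.
  by rewrite e' -!catA.
by move/(congr1 rev); rewrite !rev_cat => /(congr1 (drop (size (rev l))));
  rewrite !drop_size_cat // => /(can_inj revK).
Qed.

Lemma occurrence_at (u w : word) (p : nat) : prefix u (drop p w) ->
  w = take p w ++ u ++ drop (size u) (drop p w).
Proof.
by move=> /prefixP[y e]; rewrite {1}e drop_size_cat // -e cat_take_drop.
Qed.

Lemma repeatedP (u w : word) : 1 < nocc u w <-> repeated u w.
Proof.
rewrite /nocc -size_filter; set s := filter _ _.
have us : uniq s by rewrite filter_uniq ?iota_uniq.
have s_at x y : w = x ++ u ++ y -> size x \in s.
  move=> e; rewrite mem_filter mem_iota e drop_size_cat // prefix_prefix.
  by rewrite !size_cat /=; lia.
split=> [s2 | [x [y [x' [y' [e e' nx]]]]]].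
  have /[!mem_filter]/andP[op lp] := mem_nth 0 (ltnW s2).
  have /[!mem_filter]/andP[oq lq] := mem_nth 0 s2.
  have npq : nth 0 s 0 <> nth 0 s 1 by move/eqP; rewrite nth_uniq // ltnW.
  move: lp lq; rewrite !mem_iota !add0n !ltnS /= => lp lq.
  have ep := occurrence_at _ _ _ op; have eq' := occurrence_at _ _ _ oq.
  exists (take (nth 0 s 0) w), (drop (size u) (drop (nth 0 s 0) w)),
    (take (nth 0 s 1) w), (drop (size u) (drop (nth 0 s 1) w)).
  by split=> // /(congr1 size); rewrite !size_takel.
have := @uniq_leq_size _ [:: size x; size x'] s; apply.
  rewrite /= inE andbT; apply/eqP => ss; apply: nx.
  have : take (size x) w = take (size x) w by [].
  by rewrite {1}e e' take_size_cat // ss take_size_cat.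
by move=> p; rewrite !inE => /orP[]/eqP->; [apply: s_at e | apply: s_at e'].
Qed.

Lemma nocc_gt0 (u x y : word) : 0 < nocc u (x ++ u ++ y).
Proof.
rewrite /nocc -has_count; apply/hasP; exists (size x).
  by rewrite mem_iota !size_cat; lia.
by rewrite drop_size_cat // prefix_prefix.
Qed.

(** * Factors as intervals of positions *)

Lemma factor_cat (x u y : word) :
  factor (x ++ u ++ y) (size x).+1 (size x + size u) = u.
Proof. by rewrite /factor /= subSS addKn drop_size_cat // take_size_cat. Qed.

Lemma factor_split (w : word) (p q : nat) : p <= q ->
  w = take p w ++ factor w p.+1 q ++ drop q w.
Proof.
move=> pq; rewrite /factor /= subSS.
by rewrite -{2}(subnK pq) -drop_drop cat_take_drop cat_take_drop.
Qed.

Lemma nocc_factor_mono (w : word) (p q p' q' : nat) : p <= p' -> p' <= q' -> q' <= q ->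
  1 < nocc (factor w p.+1 q) w -> 1 < nocc (factor w p'.+1 q') w.
Proof.
move=> pp pq qq /repeatedP rep; apply/repeatedP; move: rep.
have -> : factor w p.+1 q = take (p' - p) (drop p w) ++ factor w p'.+1 q'
    ++ take (q - q') (drop q' w).
  rewrite /factor /= !subSS.
  have -> : q - p = (p' - p) + ((q' - p') + (q - q')) by lia.
  by rewrite !takeD !drop_drop (subnK pp) (subnK pq).
exact: repeated_infix.
Qed.

(* Intervals [p, q) are 0-based and half-open, so [p, q) is [factor w p.+1 q]. *)
Lemma two_MUS (w : word) (p1 q1 p2 q2 : nat) :
  p1 < q1 -> p1 < p2 -> p2 < q2 -> q1 < q2 -> q2 <= size w ->
  ~ 1 < nocc (factor w p1.+1 q1) w -> ~ 1 < nocc (factor w p2.+1 q2) w ->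
  1 < nocc (factor w 1 q1.-1) w -> 1 < nocc (factor w p1.+2 q2.-1) w ->
  1 < nocc (factor w p2.+2 (size w)) w ->
  forall u, is_MUS w u <-> u = factor w p1.+1 q1 \/ u = factor w p2.+1 q2.
Proof.
move=> h1 h12 h2 h12' hw U1 U2 R1 R2 R3 u.
have mono p q p' q' := @nocc_factor_mono w p q p' q'.
have once p q : p <= q -> ~ 1 < nocc (factor w p.+1 q) w ->
    nocc (factor w p.+1 q) w = 1.
  move=> pq /negP; rewrite -leqNgt => n1; apply/eqP; rewrite eqn_leq n1 /=.
  by rewrite [X in nocc _ X](factor_split w p q pq) nocc_gt0.
split=> [[u1 [[|p] [q [[/andP[i1 pq] qw] eu Rl Rr]]]]|] //; last first.
  case=> ->; (split; first by apply: once => //; lia).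
    exists p1.+1, q1; split=> //; first by lia.
      by apply: mono R2; lia.
    by apply: mono R1; lia.
  exists p2.+1, q2; split=> //.
    by apply: mono R3; lia.
  by apply: mono R2; lia.
have nu : ~ 1 < nocc (factor w p.+1 q) w by rewrite -eu u1.
(* If one of [c1], [c3], [c2] failed, [p, q) would lie inside one of the three repeated intervals.
   Together they make [p, q) contain [p1, q1) or [p2, q2). *)
have c1 : q1 <= q.
  by case: leqP => // ?; case: nu; apply: mono R1; lia.
have c3 : p <= p2.
  by case: leqP => // ?; case: nu; apply: mono R3; lia.
have c2 : p <= p1 \/ q2 <= q.
  case: (leqP p p1) => ?; first by left.
  by right; case: leqP => // ?; case: nu; apply: mono R2; lia.
(* Were the containment strict, shortening [p, q) by one letter at some end would leave a repeated
   factor still containing a unique one. *)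
rewrite eu; case: c2 => [c2|c2].
  left; congr (factor w _.+1 _).
    case: (ltngtP p p1) => // ?; [|lia].
    by case: U1; apply: mono Rl; lia.
  by case: (ltngtP q q1) => // ?; [lia|]; case: U1; apply: mono Rr; lia.
right; congr (factor w _.+1 _).
  case: (ltngtP p p2) => // ?; [|lia].
  by case: U2; apply: mono Rl; lia.
by case: (ltngtP q q2) => // ?; [lia|]; case: U2; apply: mono Rr; lia.
Qed.

(** * Desubstitution through [phi] *)

Lemma phi_cat (u v : word) : phi (u ++ v) = phi u ++ phi v.
Proof. by rewrite /phi map_cat flatten_cat. Qed.

(** Every [a] opens the image of a letter, so a cut before it falls between two images. *)
Lemma phi_split_a (w x y : word) : phi w = x ++ a :: y ->
  exists w1 w2, [/\ w = w1 ++ w2, x = phi w1 & phi w2 = a :: y].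
Proof.
elim: w x => [|c w IH] [|d x] //; first by exists [::], (c :: w).
case: c => [|] /= [<-].
  by case: x => [|e x] //= [<-] /IH[w1 [w2 [-> -> e2]]]; exists (a :: w1), w2.
by move=> /IH[w1 [w2 [-> -> e2]]]; exists (b :: w1), w2.
Qed.

(** A [b] only arises as the second letter of the image of [a]. *)
Lemma phi_split_b (w x y : word) : phi w = x ++ b :: y ->
  exists w1 w2, [/\ w = w1 ++ a :: w2, x = phi w1 ++ [:: a] & phi w2 = y].
Proof.
elim: w x => [|c w IH] [|d x] //; first by case: c.
case: c => [|] /= [<-].
  case: x => [[<-]|e x] /=; first by exists [::], w.
  by move=> [<-] /IH[w1 [w2 [-> -> e2]]]; exists (a :: w1), w2.
by move=> /IH[w1 [w2 [-> -> e2]]]; exists (b :: w1), w2.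
Qed.

(** Used to exclude images starting with [b]; the default [a] covers the empty word. *)
Lemma phi_head (w : word) : head a (phi w) = a.
Proof. by case: w => [|[]]. Qed.

Lemma phi_inj : injective phi.
Proof.
elim=> [|[] u IH] [|[] v] //=.
- by move=> [/IH->].
- by move=> [] e; have := phi_head v; rewrite -[phi v]e.
- by move=> [] e; have := phi_head u; rewrite [phi u]e.
by move=> [/IH->].
Qed.

(** Each border [b] is preceded by the [a] of the same image, so both borders come from the letter
    [a]. *)
Lemma phi_bordered_b (w g x y : word) :
  phi w = x ++ (b :: rcons (phi g ++ [:: a]) b) ++ y ->
  exists w1 w2, w = w1 ++ (a :: rcons g a) ++ w2 /\ x = phi w1 ++ [:: a].
Proof.
rewrite cat_cons cat_rcons -catA => /phi_split_b[w1 [w2 [-> ->]]].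
move=> /phi_split_a[v1 [v2 [-> /phi_inj<-]]].
case: v2 => [|[] v2] //=; last first.
  by move=> [] e; have := phi_head v2; rewrite [phi v2]e.
by move=> _; exists w1, v2; rewrite cat_rcons.
Qed.

Lemma phi_bordered_a (w g x y : word) :
  phi w = x ++ (a :: rcons (phi g ++ [:: a]) a) ++ y ->
  exists w1 w2, w = w1 ++ (b :: rcons g b) ++ w2 /\ x = phi w1.
Proof.
rewrite cat_cons cat_rcons -catA => /phi_split_a[w1 [w2 [-> ->]]].
case: w2 => [|[] w2] //=.
  (* The left border is followed by [a], since [phi g ++ [:: a]] starts with [a]; hence it is not
     the start of the image of [a]. *)
  by move=> [] e; have := phi_head g; move: e; case: (phi g) => [|? ?] //= [<-].
move=> [] /phi_split_a[v1 [v2 [-> /phi_inj<-]]].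
case: v2 => [|[] v2] //= _.
by exists w1, v2; rewrite cat_rcons.
Qed.

(** Each left context in [phi w] is determined by the one it comes from in [w], so distinct
    occurrences have distinct preimages. *)
Lemma repeated_phi (c : letter) (g w : word) :
  repeated (compl c :: rcons (phi g ++ [:: a]) (compl c)) (phi w) ->
  repeated (c :: rcons g c) w.
Proof.
case: c => -[x [y [x' [y' []]]]].
  move=> /phi_bordered_b[w1 [w2 [e ->]]] /phi_bordered_b[w1' [w2' [e' ->]]] n.
  by exists w1, w2, w1', w2'; split=> // ew; case: n; rewrite ew.
move=> /phi_bordered_a[w1 [w2 [e ->]]] /phi_bordered_a[w1' [w2' [e' ->]]] n.
by exists w1, w2, w1', w2'; split=> // ew; case: n; rewrite ew.
Qed.

(** * Fibonacci words *)

Lemma phi_F (n : nat) : phi (F n.+1) = F n.+2.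
Proof. by []. Qed.

Lemma F_rec (n : nat) : F n.+3 = F n.+2 ++ F n.+1.
Proof. by elim: n => // n IH; rewrite -[LHS]phi_F IH phi_cat !phi_F -IH. Qed.

Lemma alphaS (n : nat) : alpha n.+1 = compl (alpha n).
Proof. by rewrite /alpha /=; case: odd. Qed.

Lemma complK : involutive compl.
Proof. by case. Qed.

Lemma G_of_F (n : nat) (g : word) (c d : letter) : F n = g ++ [:: c; d] -> G n = g.
Proof.
move=> e; rewrite /G /factor e /= drop0 size_cat /= addn2 !subSS !subn0.
by rewrite take_size_cat.
Qed.

(** Expanding [F n.+3] by the recurrence brings out [F n.+2] in front of the previous pair of
    products, with their roles exchanged. *)
Lemma F_near_commute (n : nat) :
  exists2 g, F n.+2 ++ F n.+1 = g ++ [:: compl (alpha n.+3); alpha n.+3]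
           & F n.+1 ++ F n.+2 = g ++ [:: alpha n.+3; compl (alpha n.+3)].
Proof.
elim: n => [|n [g e1 e2]]; first by exists [::].
exists (F n.+2 ++ g); last by rewrite F_rec e1 (alphaS n.+3) complK -catA.
by rewrite F_rec -catA e2 (alphaS n.+3) complK -catA.
Qed.

Lemma F_eq (n : nat) : F n.+3 = G n.+3 ++ [:: compl (alpha n.+3); alpha n.+3].
Proof.
have [g e _] := F_near_commute n.
by rewrite -F_rec in e; rewrite (G_of_F _ _ _ _ e).
Qed.

Lemma F_comm (n : nat) :
  F n.+1 ++ F n.+2 = G n.+3 ++ [:: alpha n.+3; compl (alpha n.+3)].
Proof.
have [g e ->] := F_near_commute n.
by rewrite -F_rec in e; rewrite (G_of_F _ _ _ _ e).
Qed.

(** The last two letters of [F n.+3] have image [aba] or [aab]; removing two letters leaves [a] in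
    both cases. *)
Lemma G_phi (n : nat) : G n.+4 = phi (G n.+3) ++ [:: a].
Proof.
have := phi_F n.+2; rewrite F_eq phi_cat.
by case: (alpha _) => /= e;
  [apply: (@G_of_F _ _ a b) | apply: (@G_of_F _ _ b a)]; rewrite -e -catA.
Qed.

Lemma size_G (n : nat) : size (F n.+3) = (size (G n.+3)).+2.
Proof. by rewrite F_eq size_cat addn2. Qed.

Lemma first_candidate_unique (n : nat) :
  ~ repeated (alpha n :: rcons (G n.+3) (alpha n)) (F n.+3.+3).
Proof.
(* In the base case the count in [F 6], the word [abaababa], is computed. *)
elim: n => [|n IH]; first by move/repeatedP.
by rewrite alphaS G_phi -phi_F => /repeated_phi.
Qed.

Lemma second_candidate_unique (n : nat) :
  ~ repeated (compl (alpha n) :: rcons (G n.+4) (compl (alpha n))) (F n.+3.+3).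
Proof.
elim: n => [|n IH]; first by move/repeatedP.
by rewrite alphaS G_phi -phi_F => /repeated_phi.
Qed.

Theorem theorem33 (i : nat) (hi : 6 <= i) (u : word) :
  is_MUS (F i) u <->
  u = alpha i :: rcons (G (i - 3)) (alpha i) \/
  u = compl (alpha i) :: rcons (G (i - 2)) (compl (alpha i)).
Proof.
case: i hi => [|[|[|[|[|[|n]]]]]] // _.
rewrite !subSS subn0 (_ : alpha n.+3.+3 = alpha n); last by rewrite !alphaS !complK.
have a3 : alpha n.+3 = compl (alpha n) by rewrite !alphaS !complK.
have a4 : alpha n.+4 = alpha n by rewrite !alphaS !complK.
have a5 : alpha n.+4.+1 = compl (alpha n) by rewrite !alphaS !complK.
have s3 := size_G n; have s4 := size_G n.+1; have s5 := size_G n.+2.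
have r5 : size (F n.+4.+1) = size (F n.+4) + size (F n.+3) by rewrite F_rec size_cat.
have r6 : size (F n.+3.+3) = size (F n.+4.+1) + size (F n.+4).
  by rewrite F_rec size_cat.
(* The first candidate straddles the first two blocks of [F n.+4 ++ F n.+3 ++ F n.+4]; in [eV] the
   second one straddles [F n.+4.+1 ++ F n.+4]. *)
have eU : F n.+3.+3 = (G n.+4 ++ [:: compl (alpha n)]) ++
    (alpha n :: rcons (G n.+3) (alpha n)) ++ compl (alpha n) :: F n.+4.
  rewrite F_rec F_rec {1}(F_eq n.+1) a4 (F_eq n) a3 complK.
  by rewrite -cats1 /= -!catA /= -?catA.
have eV : F n.+3.+3 = (G n.+4.+1 ++ [:: alpha n]) ++
    (compl (alpha n) :: rcons (G n.+4) (compl (alpha n))) ++ [:: alpha n].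
  rewrite F_rec (F_eq n.+2) a5 (F_eq n.+1) a4 complK.
  by rewrite -cats1 /= -!catA /= -?catA.
have eX1 : F n.+3.+3 = [::] ++ G n.+4.+1 ++ alpha n :: compl (alpha n) :: F n.+4.
  by rewrite F_rec (F_eq n.+2) a5 complK -catA.
have eX2 : F n.+3.+3 = F n.+4 ++ G n.+4.+1 ++ [:: compl (alpha n); alpha n].
  by rewrite F_rec F_rec -catA F_comm a5 complK.
have eX3 : F n.+3.+3 = F n.+4.+1 ++ F n.+4 ++ [::] by rewrite cats0 F_rec.
have eX4 : F n.+3.+3 = [::] ++ F n.+4 ++ F n.+3 ++ F n.+4.
  by rewrite F_rec F_rec -catA.
have rep5 : 1 < nocc (G n.+4.+1) (F n.+3.+3).
  apply/repeatedP; do 4 eexists; split; [exact: eX1 | exact: eX2 |].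
  by move/(congr1 size); rewrite s4.
have rep4 : 1 < nocc (F n.+4) (F n.+3.+3).
  apply/repeatedP; do 4 eexists; split; [exact: eX3 | exact: eX4 |].
  by move/(congr1 size); rewrite s5.
have fU := factor_cat (G n.+4 ++ [:: compl (alpha n)])
    (alpha n :: rcons (G n.+3) (alpha n)) (compl (alpha n) :: F n.+4).
have fV := factor_cat (G n.+4.+1 ++ [:: alpha n])
    (compl (alpha n) :: rcons (G n.+4) (compl (alpha n))) [:: alpha n].
have fX1 := factor_cat [::] (G n.+4.+1) (alpha n :: compl (alpha n) :: F n.+4).
have fX2 := factor_cat (F n.+4) (G n.+4.+1) [:: compl (alpha n); alpha n].
have fX3 := factor_cat (F n.+4.+1) (F n.+4) [::].
rewrite -eU in fU; rewrite -eV in fV.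
rewrite -eX1 in fX1; rewrite -eX2 in fX2; rewrite -eX3 in fX3.
(* With f_k the length of [F k], the candidates occupy [f_(n+4) - 1, f_(n+5) - 1) and [f_(n+5) - 1,
   f_(n+6) - 1). The three repeated intervals then spell [G n.+4.+1] twice and [F n.+4]. *)
rewrite -fU -fV; apply: two_MUS;
  rewrite ?fU ?fV; rewrite /= ?size_cat ?size_rcons /=; try lia.
- by move/repeatedP/first_candidate_unique.
- by move/repeatedP/second_candidate_unique.
- rewrite [X in nocc X](_ : _ = G n.+4.+1) // -[RHS]fX1.
  by congr factor; rewrite /=; lia.
- rewrite [X in nocc X](_ : _ = G n.+4.+1) // -[RHS]fX2.
  by congr factor; lia.
rewrite [X in nocc X](_ : _ = F n.+4) // -[RHS]fX3.
by congr factor; lia.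
Qed.
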